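(* For every positive integer $m$ and every real $\alpha$ with $\alpha\leq\frac{3}{2}(m^2-1)$ (and $\alpha\geq 1$, so that the notions below are defined), there do not exist Kähler manifolds of complex dimension $m$ with $\alpha$-positive or $\alpha$-negative curvature operator of the second kind.
   Context: Manifolds are nonempty. Sign convention: the Riemann curvature tensor $R$ is normalized so that $R(X,Y,X,Y)$ is the sectional curvature of the plane spanned by orthonormal $X,Y$ (positive on round spheres). For a Riemannian manifold $(M^n,g)$ and $p\in M$, let $S^2_0(T_pM)$ be the space of traceless symmetric two-tensors on $T_pM$ with inner product $\langle A,B\rangle=\operatorname{tr}(A^TB)$, and let $N=\dim S^2_0(T_pM)=\frac{(n-1)(n+2)}{2}$. The curvature operator of the second kind is the symmetric bilinear form on $S^2_0(T_pM)$ given in an orthonormal basis by $\mathring{R}(\varphi,\psi)=\sum_{i,j,k,l=1}^n R_{ijkl}\varphi_{il}\psi_{jk}$. For a real number $\alpha\in[1,N]$, $(M,g)$ has $\alpha$-positive curvature operator of the second kind if for every $p\in M$ and every orthonormal basis $\{\varphi_i\}_{i=1}^N$ of $S^2_0(T_pM)$, $$\sum_{i=1}^{\lfloor\alpha\rfloor}\mathring{R}(\varphi_i,\varphi_i)+(\alpha-\lfloor\alpha\rfloor)\mathring{R}(\varphi_{\lfloor\alpha\rfloor+1},\varphi_{\lfloor\alpha\rfloor+1})>0,$$ where the last term is absent when $\alpha$ is an integer, and $\alpha$-negative curvature operator of the second kind if the reversed strict inequality $<0$ always holds. A Kähler manifold of complex dimension $m$ has real dimension $n=2m$. *)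

(* Defs.v *)
From HB Require Import structures.
From mathcomp Require Import all_boot all_order all_algebra.
From mathcomp Require Import all_classical all_reals all_analysis.

Set Implicit Arguments.
Unset Strict Implicit.
Unset Printing Implicit Defensive.

Import Order.TTheory GRing.Theory Num.Theory.
Import numFieldNormedType.Exports.

Local Open Scope classical_set_scope.
Local Open Scope ring_scope.

(** * Calculus on open subsets of R^n *)

Definition pderiv (R : realType) (n : nat) (i : 'I_n) (f : 'rV[R]_n -> R) :
    'rV[R]_n -> R :=
  fun x => 'D_(delta_mx 0 i) f x.

(* All partial derivatives of order at most [k] exist and are continuous on
   [U]; only used for open [U]. *)
Fixpoint Ck (R : realType) (n k : nat) (U : set 'rV[R]_n)
    (f : 'rV[R]_n -> R) : Prop :=
  (forall x, U x -> {for x, continuous f}) /\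
  match k with
  | 0 => True
  | k'.+1 => forall i : 'I_n,
      (forall x, U x -> derivable f x (delta_mx 0 i)) /\ Ck k' U (pderiv i f)
  end.

Definition smooth_on (R : realType) (n : nat) (U : set 'rV[R]_n)
    (f : 'rV[R]_n -> R) : Prop :=
  forall k, Ck k U f.

(** * Complex manifolds *)

(* C^m is R^(m + m) with coordinates (x_1, .., x_m, y_1, .., y_m); vectors are
   rows, and multiplication by the imaginary unit is [v |-> v *m stdJ], that is
   d/dx_a |-> d/dy_a and d/dy_a |-> - d/dx_a. *)
Definition stdJ (R : realType) (m : nat) : 'M[R]_(m + m) :=
  block_mx 0 1%:M (- 1%:M) 0.

(* Holomorphic = smooth with complex linear differential (Cauchy-Riemann). *)
Definition holomorphic_on (R : realType) (m : nat) (U : set 'rV[R]_(m + m))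
    (f : 'rV[R]_(m + m) -> 'rV[R]_(m + m)) : Prop :=
  (forall b : 'I_(m + m), smooth_on U (fun x => f x 0 b)) /\
  (forall x, U x -> stdJ R m *m 'J f x = 'J f x *m stdJ R m).

(* [chart_map c] is a homeomorphism of the open set [chart_dom c] onto an open
   subset of C^m, with inverse [chart_inv c]; the values of these total
   functions outside their domains are irrelevant. *)
Record complexManifold (R : realType) (m : nat) := ComplexManifold {
  cm_space :> topologicalType ;
  cm_hausdorff : hausdorff_space cm_space ;
  cm_second_countable : @second_countable cm_space ;
  cm_nonempty : [set: cm_space] !=set0 ;
  chart : Type ;
  chart_dom : chart -> set cm_space ;
  chart_map : chart -> cm_space -> 'rV[R]_(m + m) ;
  chart_inv : chart -> 'rV[R]_(m + m) -> cm_space ;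
  chart_cover : forall p : cm_space, exists c, chart_dom c p ;
  chart_dom_open : forall c, open (chart_dom c) ;
  chart_img_open : forall c, open (chart_map c @` chart_dom c) ;
  chart_mapK : forall c p, chart_dom c p -> chart_inv c (chart_map c p) = p ;
  chart_map_cont : forall c, {within chart_dom c, continuous (chart_map c)} ;
  chart_inv_cont : forall c,
    {within chart_map c @` chart_dom c, continuous (chart_inv c)} ;
  chart_transition : forall c d,
    holomorphic_on (chart_map c @` (chart_dom c `&` chart_dom d))
                   (chart_map d \o chart_inv c) }.

Definition chart_img (R : realType) (m : nat) (M : complexManifold R m)
    (c : chart M) : set 'rV[R]_(m + m) :=
  chart_map c @` chart_dom c.

(** * Riemannian and Kaehler metrics *)

(* A metric is given by its matrices [rm_mx c x] of components
   g(d/dx_a, d/dx_b) in the charts; as vectors are rows, g(u, v) is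
   [u *m rm_mx c x *m v^T], and the last field is the transformation law of a
   covariant 2-tensor. *)
Record riemannianMetric (R : realType) (m : nat) (M : complexManifold R m) :=
  RiemannianMetric {
  rm_mx :> chart M -> 'rV[R]_(m + m) -> 'M[R]_(m + m) ;
  rm_smooth : forall c (a b : 'I_(m + m)),
    smooth_on (chart_img c) (fun x => rm_mx c x a b) ;
  rm_sym : forall c x, chart_img c x -> (rm_mx c x)^T = rm_mx c x ;
  rm_posdef : forall c x, chart_img c x ->
    forall v : 'rV[R]_(m + m), v != 0 -> 0 < (v *m rm_mx c x *m v^T) 0 0 ;
  rm_transition : forall c d p, chart_dom c p -> chart_dom d p ->
    let D := 'J (chart_map d \o chart_inv c) (chart_map c p) in
    rm_mx c (chart_map c p) = D *m rm_mx d (chart_map d p) *m D^T }.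

(* g(J u, J v) = g(u, v) *)
Definition hermitian (R : realType) (m : nat) (M : complexManifold R m)
    (g : riemannianMetric M) : Prop :=
  forall (c : chart M) x, chart_img c x ->
    stdJ R m *m g c x *m (stdJ R m)^T = g c x.

(* Components of omega(u, v) = g(J u, v). *)
Definition fundamental_form (R : realType) (m : nat) (M : complexManifold R m)
    (g : riemannianMetric M) (c : chart M) (x : 'rV[R]_(m + m)) :
    'M[R]_(m + m) :=
  stdJ R m *m g c x.

(* d omega = 0, in components. *)
Definition fundamental_form_closed (R : realType) (m : nat)
    (M : complexManifold R m) (g : riemannianMetric M) : Prop :=
  forall (c : chart M) x, chart_img c x -> forall a b d : 'I_(m + m),
    pderiv a (fun y => fundamental_form g c y b d) x +
    pderiv b (fun y => fundamental_form g c y d a) x +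
    pderiv d (fun y => fundamental_form g c y a b) x = 0.

Record kaehlerManifold (R : realType) (m : nat) := KaehlerManifold {
  km_manifold :> complexManifold R m ;
  km_metric : riemannianMetric km_manifold ;
  km_hermitian : hermitian km_metric ;
  km_closed : fundamental_form_closed km_metric }.

(** * Curvature of a metric in local coordinates *)

(* Gamma^k_ij of the Levi-Civita connection. *)
Definition christoffel (R : realType) (n : nat) (g : 'rV[R]_n -> 'M[R]_n)
    (k i j : 'I_n) (x : 'rV[R]_n) : R :=
  2^-1 * \sum_(l < n) invmx (g x) k l *
    (pderiv i (fun y => g y j l) x + pderiv j (fun y => g y i l) x
     - pderiv l (fun y => g y i j) x).

(* d/dx_l-component of R(d/dx_i, d/dx_j) d/dx_k, where
   R(X, Y) Z = nabla_X nabla_Y Z - nabla_Y nabla_X Z - nabla_[X, Y] Z. *)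
Definition riemann_endo (R : realType) (n : nat) (g : 'rV[R]_n -> 'M[R]_n)
    (i j k l : 'I_n) (x : 'rV[R]_n) : R :=
  pderiv i (christoffel g l j k) x - pderiv j (christoffel g l i k) x
  + \sum_(s < n) (christoffel g s j k x * christoffel g l i s x
                  - christoffel g s i k x * christoffel g l j s x).

(* R(X, Y, Z, W) = g(R(X, Y) W, Z), so that R(X, Y, X, Y) is the sectional
   curvature of an orthonormal pair. *)
Definition riemann (R : realType) (n : nat) (g : 'rV[R]_n -> 'M[R]_n)
    (x X Y Z W : 'rV[R]_n) : R :=
  \sum_(i < n) \sum_(j < n) \sum_(k < n) \sum_(l < n)
    X 0 i * Y 0 j * Z 0 k * W 0 l *
    (\sum_(s < n) g x k s * riemann_endo g i j l s x).

(** * The curvature operator of the second kind *)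

(* The rows of [E] form an orthonormal basis for the inner product [G]. *)
Definition orthonormal_frame (R : realType) (n : nat) (G E : 'M[R]_n) : Prop :=
  E *m G *m E^T = 1%:M.

(* Two-tensors are represented by their components in an orthonormal basis of
   the tangent space. *)
Definition S20 (R : realType) (n : nat) (A : 'M[R]_n) : Prop :=
  A^T = A /\ \tr A = 0.

Definition dimS20 (n : nat) : nat := (n.-1 * n.+2) %/ 2.

Definition orthonormal_basis_S20 (R : realType) (n : nat)
    (phi : 'I_(dimS20 n) -> 'M[R]_n) : Prop :=
  [/\ forall i, S20 (phi i),
      forall i j, \tr ((phi i)^T *m phi j) = (i == j)%:R &
      forall A, S20 A -> exists c : 'I_(dimS20 n) -> R,
        A = \sum_(i < dimS20 n) c i *: phi i].

Definition curv_op2 (R : realType) (n : nat) (g : 'rV[R]_n -> 'M[R]_n)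
    (x : 'rV[R]_n) (E phi psi : 'M[R]_n) : R :=
  \sum_(i < n) \sum_(j < n) \sum_(k < n) \sum_(l < n)
    riemann g x (row i E) (row j E) (row k E) (row l E) * phi i l * psi j k.

(* f_1 + .. + f_floor(alpha) + (alpha - floor(alpha)) f_(floor(alpha) + 1) with
   indices shifted to start at 0, for 0 <= alpha <= N; the last sum has at most
   one term, and none when alpha = N. *)
Definition frac_sum (R : realType) (N : nat) (alpha : R) (f : 'I_N -> R) : R :=
  \sum_(i < N | (i < Num.truncn alpha)%N) f i +
  (alpha - (Num.truncn alpha)%:R) *
    \sum_(i < N | nat_of_ord i == Num.truncn alpha) f i.

(* The tangent space at [p] is described in any chart [c] around [p]. *)
Definition alpha_positive (R : realType) (m : nat) (M : kaehlerManifold R m)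
    (alpha : R) : Prop :=
  forall (p : M) (c : chart M), chart_dom c p ->
  forall E, orthonormal_frame (km_metric M c (chart_map c p)) E ->
  forall phi : 'I_(dimS20 (m + m)) -> 'M[R]_(m + m), orthonormal_basis_S20 phi ->
  0 < frac_sum alpha
        (fun i => curv_op2 (km_metric M c) (chart_map c p) E (phi i) (phi i)).

Definition alpha_negative (R : realType) (m : nat) (M : kaehlerManifold R m)
    (alpha : R) : Prop :=
  forall (p : M) (c : chart M), chart_dom c p ->
  forall E, orthonormal_frame (km_metric M c (chart_map c p)) E ->
  forall phi : 'I_(dimS20 (m + m)) -> 'M[R]_(m + m), orthonormal_basis_S20 phi ->
  frac_sum alpha
    (fun i => curv_op2 (km_metric M c) (chart_map c p) E (phi i) (phi i)) < 0.

(* Main.v *)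
Require Import Defs.
From HB Require Import structures.
From mathcomp Require Import all_boot all_order all_algebra.
From mathcomp Require Import all_classical all_reals all_analysis.
From mathcomp Require Import ring lra zify.

(* Everything happens at one point.  In an orthonormal frame the complex
   structure is a skew matrix [K] with [K^2 = -1], and, since [nabla J = 0], the
   curvature endomorphisms commute with [K].  The traceless symmetric matrices
   split orthogonally into the [K]-invariant ones (dimension m^2 - 1) and the
   anti-invariant ones (dimension m (m + 1)).  Antisymmetry, the first Bianchi
   identity and commutation with [K] suffice to compute the trace of the
   curvature operator of the second kind on the two summands:
   - (m - 1) / (2 m) S and S respectively, where S is the scalar curvature.
   Hence the sum of the diagonal values in an adapted orthonormal basis, with
   weight 1 on the first summand and (m - 1) / (2 m) on the second, vanishes.
   These weights lie in [0, 1] and add up to 3/2 (m^2 - 1), so, rescaled to total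
   alpha, they give an upper bound 0 for the fractional sum of the values in
   increasing order; the same applied to the opposite curvature excludes
   alpha-negativity. *)

Set Implicit Arguments.
Unset Strict Implicit.
Unset Printing Implicit Defensive.

Import Order.TTheory GRing.Theory Num.Theory.
Import numFieldNormedType.Exports.

Local Open Scope ring_scope.

(** * Fractional sums *)

Lemma frac_sum_weights (R : realType) (N : nat) (alpha : R) (f : 'I_N -> R) :
  frac_sum alpha f = \sum_(i < N) ((i < Num.truncn alpha)%N%:R
    + (alpha - (Num.truncn alpha)%:R) * (nat_of_ord i == Num.truncn alpha)%:R)
    * f i.
Proof.
rewrite /frac_sum big_mkcond [X in _ * X]big_mkcond mulr_sumr -big_split /=.
by apply: eq_bigr => i _; do 2!case: ifP => _ /=; ring.
Qed.

Lemma frac_sumN (R : realType) (N : nat) (alpha : R) (f : 'I_N -> R) :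
  frac_sum alpha (fun i => - f i) = - frac_sum alpha f.
Proof. by rewrite /frac_sum !sumrN mulrN opprD. Qed.

(** The weights add up to [alpha] because the index carrying the fractional part lies in range when
    the floor is below [N]. *)
Lemma frac_sum_cst (R : realType) (N : nat) (alpha : R) :
  (Num.truncn alpha < N)%N -> frac_sum alpha (fun _ : 'I_N => 1) = alpha.
Proof.
move=> ltkN; rewrite /frac_sum [X in _ * X](big_pred1 (Ordinal ltkN)) //.
have -> : \sum_(i < N | (i < Num.truncn alpha)%N) (1 : R)
        = (Num.truncn alpha)%:R.
  rewrite -(big_ord_widen N (fun=> 1) (ltnW ltkN)).
  by rewrite sumr_const card_ord.
ring.
Qed.

(* Comparing values with the pivot [a k], [k] the floor of [alpha], every term of
   [\sum_i (w i - v i) * (a i - a k)] is nonnegative, where [v] is the weight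
   vector of [frac_sum]. *)
Lemma frac_sum_sorted_le (R : realType) (N : nat) (alpha : R)
    (a w : 'I_N -> R) :
  0 <= alpha -> (Num.truncn alpha < N)%N ->
  (forall i j : 'I_N, (i <= j)%N -> a i <= a j) ->
  (forall i, 0 <= w i <= 1) -> \sum_i w i = alpha ->
  frac_sum alpha a <= \sum_i w i * a i.
Proof.
move=> alpha0 ltkN mono_a w01 sum_w; set k := Num.truncn alpha in ltkN *.
have kle : k%:R <= alpha by rewrite truncn_le.
have := frac_sum_cst ltkN; rewrite !frac_sum_weights -/k.
set v := fun i : 'I_N => (i < k)%N%:R + (alpha - k%:R) * (nat_of_ord i == k)%:R.
rewrite (eq_bigr v) => [sum_v|i _]; last by rewrite mulr1.
rewrite -subr_ge0 -sumrB.
have -> : \sum_i (w i * a i - v i * a i)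
        = \sum_i (w i - v i) * (a i - a (Ordinal ltkN)).
  transitivity (\sum_i (w i - v i) * (a i - a (Ordinal ltkN))
     + (\sum_i w i - \sum_i v i) * a (Ordinal ltkN)).
    rewrite -sumrB mulr_suml -big_split /=; apply: eq_bigr => i _; ring.
  by rewrite sum_w sum_v subrr mul0r addr0.
apply: sumr_ge0 => i _; have /andP[w0 w1] := w01 i; rewrite /v.
case: (ltngtP i k) => [ltik|gtik|eqik] /=.
- rewrite mulr0 addr0 mulr_le0 // subr_le0 //.
  exact: mono_a (Ordinal ltkN) (ltnW ltik).
- rewrite mulr0 addr0 subr0 mulr_ge0 // subr_ge0.
  exact: (mono_a (Ordinal ltkN)) (ltnW gtik).
- have -> : i = Ordinal ltkN by apply: val_inj.
  by rewrite subrr mulr0.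
Qed.

Lemma exists_sorted_bijection (R : realType) (I : finType) (a : I -> R) :
  exists2 s : 'I_#|I| -> I, bijective s &
    forall i j : 'I_#|I|, (i <= j)%N -> a (s i) <= a (s j).
Proof.
pose r := [rel x y | a x <= a y]; pose t := sort r (enum I).
have tr_r : transitive r by move=> y x z; apply: le_trans.
have sz : size t == #|I| by rewrite size_sort cardE.
exists (tnth (Tuple sz)).
  apply: inj_card_bij; last by rewrite card_ord.
  by apply/tuple_uniqP; rewrite sort_uniq enum_uniq.
move=> i j leij; have x0 := tnth (Tuple sz) i; rewrite !(tnth_nth x0) /=.
have st : sorted r t by apply: sort_sorted => x y; apply: le_total.
apply: (sorted_leq_nth tr_r _ _ st) => //; first by move=> x /=.
all: by rewrite inE (eqP sz).
Qed.

(** The enumeration of the values may be chosen freely, so the increasing one brings in the pivot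
    comparison; reindexing along a bijection leaves both weighted sums unchanged. *)
Lemma exists_frac_sum_le (R : realType) (I : finType) (N : nat) (alpha : R)
    (a w : I -> R) :
  #|I| = N -> 0 <= alpha -> (Num.truncn alpha < N)%N ->
  (forall i, 0 <= w i <= 1) -> \sum_i w i = alpha ->
  exists2 s : 'I_N -> I, bijective s &
    frac_sum alpha (fun i => a (s i)) <= \sum_i w i * a i.
Proof.
move=> <- alpha0 ltN w01 sum_w.
have [s bij_s mono_s] := exists_sorted_bijection a.
exists s => //; rewrite (reindex s) /=; last exact: onW_bij.
apply: (frac_sum_sorted_le (w := w \o s)) => // [i|]; first exact: w01.
by rewrite -sum_w (reindex s) //; apply: onW_bij.
Qed.

(** * Orthonormal bases *)

(** Gram-Schmidt by induction on the dimension: the first basis vector is split off, and the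
    induction hypothesis is applied to its Schur complement. *)
Lemma posdef_frame (R : realType) (n : nat) (G : 'M[R]_n) :
  G^T = G -> (forall v : 'rV[R]_n, v != 0 -> 0 < (v *m G *m v^T) 0 0) ->
  exists E : 'M[R]_n, E *m G *m E^T = 1%:M.
Proof.
elim: n G => [|n IHn] G symG posG.
  by exists 0; rewrite [LHS]flatmx0 [RHS]flatmx0.
change ('M[R]_(1 + n)) in G.
change (forall v : 'rV[R]_(1 + n), v != 0 -> 0 < (v *m G *m v^T) 0 0) in posG.
change (exists E : 'M[R]_(1 + n), E *m G *m E^T = 1%:M).
have [a [b [D eqG]]] : exists a b D, G = block_mx a%:M b b^T D.
  exists (ulsubmx G 0 0), (ursubmx G), (drsubmx G).
  rewrite -mx11_scalar trmx_ursub symG submxK //.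
have a_gt0 : 0 < a.
  have := posG (row_mx 1%:M 0 : 'rV_(1 + n)).
  rewrite eqG tr_row_mx mul_row_block mul_row_col !trmx0 !mul1mx trmx1.
  rewrite mulmx1 !mulmx0 !mul0mx !addr0 mxE eqxx mulr1n; apply.
  by rewrite row_mx_eq0 negb_and oner_eq0.
(* The rows of [E1] are the first basis vector and the other ones made [G]-orthogonal to it; [D'] is
   the Gram matrix of the latter. *)
pose E1 : 'M[R]_(1 + n) := block_mx 1%:M 0 (- a^-1 *: b^T) 1%:M.
pose D' := D - a^-1 *: (b^T *m b).
have symD : D^T = D.
  have : G^T = G by exact: symG.
  by rewrite eqG tr_block_mx => /eq_block_mx[].
have E1G : E1 *m G *m E1^T = block_mx a%:M 0 0 D'.
  rewrite eqG tr_block_mx !mulmx_block !trmx0 !trmx1 !mul1mx !mulmx1 !mul0mx.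
  rewrite !mulmx0 !addr0 linearZ /= trmxK !mul_mx_scalar !mul_scalar_mx.
  rewrite scalerA -!scalemxAl -!scalemxAr.
  rewrite mulrN mulfV ?gt_eqF // !scaleN1r addNr ?addr0.
  congr block_mx.
  - by rewrite scalerA mulrN mulfV ?gt_eqF // scaleN1r addNr.
  - rewrite [a *: _]scalerA mulrN mulfV ?gt_eqF // scaleN1r addNr mul0mx.
    by rewrite scaler0 add0r /D' scaleNr addrC.
have posD' (v : 'rV[R]_n) : v != 0 -> 0 < (v *m D' *m v^T) 0 0.
  move=> v0; pose u : 'rV[R]_(1 + n) := row_mx 0 v.
  have -> : v *m D' *m v^T = (u *m E1) *m G *m (u *m E1)^T.
    rewrite trmx_mul !mulmxA -(mulmxA _ E1 G) -(mulmxA _ (E1 *m G)) E1G.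
    rewrite tr_row_mx mul_row_block mul_row_col.
    by rewrite !mul0mx !mulmx0 !add0r mul0mx add0r.
  apply: posG; rewrite /u mul_row_block row_mx_eq0 negb_and !mulmx1 !mul0mx !add0r.
  by rewrite v0 orbT.
have symD' : D'^T = D'.
  by rewrite /D' linearB linearZ /= trmx_mul trmxK symD.
have [E' eqE'] := IHn D' symD' posD'.
exists ((block_mx ((Num.sqrt a)^-1)%:M 0 0 E' : 'M[R]_(1 + n)) *m E1).
rewrite trmx_mul !mulmxA -(mulmxA _ E1 G) -(mulmxA _ (E1 *m G)) E1G.
rewrite tr_block_mx !mulmx_block !trmx0 tr_scalar_mx.
rewrite !(mul0mx, mulmx0, addr0, add0r) eqE' -!scalar_mxM.
have -> : (Num.sqrt a)^-1 * a * (Num.sqrt a)^-1 = 1.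
  rewrite -{2}(sqr_sqrtr (ltW a_gt0)) expr2 mulKf ?mulfV //;
  by rewrite gt_eqF ?sqrtr_gt0.
by rewrite -scalar_mx_block.
Qed.

Lemma dotmx_gt0 (R : realType) (n : nat) (v : 'rV[R]_n) :
  v != 0 -> 0 < (v *m v^T) 0 0.
Proof.
move=> v0; have E : (v *m v^T) 0 0 = \sum_j v 0 j ^+ 2.
  by rewrite mxE; apply: eq_bigr => j _; rewrite mxE expr2.
rewrite E lt0r sumr_ge0 ?andbT => [|j _]; last exact: sqr_ge0.
apply: contra v0 => /eqP /psumr_eq0P v0; apply/eqP/rowP => j.
by apply/eqP; rewrite mxE -sqrf_eq0 v0 // => i _; apply: sqr_ge0.
Qed.

(** A symmetric idempotent is the orthogonal projection onto its row space, and the rows of [B] form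
    an orthonormal basis of that space. They come from any row basis, whose Gram matrix is positive
    definite by freeness. *)
Lemma orthogonal_projector_factor (R : realType) (q : nat) (P : 'M[R]_q) :
  P^T = P -> P *m P = P ->
  exists k (B : 'M[R]_(k, q)), B *m B^T = 1%:M /\ B^T *m B = P.
Proof.
move=> symP idP.
have [k [A freeA spanA]] : exists k, exists2 A : 'M[R]_(k, q),
    row_free A & (A :=: P)%MS.
  exists (\rank P), (row_base P); [exact: row_base_free | exact: eq_row_base].
have [|v v0|E eqE] := @posdef_frame R _ (A *m A^T).
- by rewrite trmx_mul trmxK.
- have -> : v *m (A *m A^T) *m v^T = (v *m A) *m (v *m A)^T.
    by rewrite trmx_mul !mulmxA.
  apply: dotmx_gt0.
  by rewrite mulmx_free_eq0.
exists k, (E *m A); set B := E *m A.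
have BB : B *m B^T = 1%:M by rewrite trmx_mul !mulmxA -(mulmxA E) eqE.
split=> //.
have [X eqB] : exists X, B = X *m P.
  by apply/submxP; rewrite (submx_trans (submxMl _ _)) ?spanA.
have [Y eqP] : exists Y, P = Y *m B.
  apply/submxP; have uE : E \in unitmx.
    by have [_] := mulmx1_unit eqE; rewrite unitmx_tr.
  rewrite (eqmxMfull A) ?row_full_unit // spanA; exact: submx_refl.
(* With [P = Y *m B] this gives [B^T *m B = P *m B^T *m B = Y *m (B *m B^T) *m B = P]. *)
have PB : P *m B^T = B^T by rewrite -{1}symP -trmx_mul eqB -mulmxA idP.
clearbody B; rewrite -PB -mulmxA {1}eqP -!mulmxA (mulmxA B) BB mul1mx.
by rewrite -eqP.
Qed.

Lemma mxvec_dot (R : realType) (n : nat) (A B : 'M[R]_n) :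
  (mxvec A *m (mxvec B)^T) 0 0 = \tr (A^T *m B).
Proof.
rewrite mxE (reindex _ (curry_mxvec_bij _ _)) /=.
rewrite (eq_bigr (fun u => A u.1 u.2 * B u.1 u.2)) => [|[i j] _]; last first.
  by rewrite mxE !mxvecE.
rewrite -(pair_bigA _ (fun i j => A i j * B i j)) exchange_big /=.
by apply: eq_bigr => j _; rewrite mxE; apply: eq_bigr => i _; rewrite mxE.
Qed.

(** Flattening matrices to row vectors turns the trace form into the dot product and [p] into a
    symmetric idempotent matrix, to be factored. The rank [k] is identified later through a
    trace. *)
Lemma projection_onb (R : realType) (n : nat)
    (p : {linear 'M[R]_n -> 'M[R]_n}) :
  (forall A, p (p A) = p A) ->
  (forall A B, \tr ((p A)^T *m B) = \tr (A^T *m p B)) ->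
  exists k (phi : 'I_k -> 'M[R]_n),
    (forall i j, \tr ((phi i)^T *m phi j) = (i == j)%:R) /\
    (forall A, p A = \sum_i \tr ((phi i)^T *m A) *: phi i).
Proof.
move=> idp adjp; pose P := lin_mx p.
have rowP (u : 'rV_(n * n)) : u *m P = mxvec (p (vec_mx u)).
  by rewrite -{1}[u]vec_mxK mul_vec_lin.
have symP : P^T = P.
  have entry i j : P i j = \tr ((p (vec_mx (delta_mx 0 i)))^T
                                *m vec_mx (delta_mx 0 j)).
    by rewrite -mxvec_dot vec_mxK -rowP -rowE trmx_delta -colE !mxE.
  by apply/matrixP => i j; rewrite mxE !entry adjp -mxtrace_tr trmx_mul trmxK.
have idP : P *m P = P.
  by apply/row_matrixP => i; rewrite !rowE mulmxA !rowP mxvecK idp.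
have [k [B [BB BtB]]] := orthogonal_projector_factor symP idP.
exists k, (fun i => vec_mx (row i B)); split=> [i j|A].
  rewrite -mxvec_dot !vec_mxK.
  have := congr1 (fun M : 'M[R]_k => M i j) BB; rewrite [in RHS]mxE => <-.
  by rewrite !mxE; apply: eq_bigr => l _; rewrite !mxE.
apply: (can_inj mxvecK); rewrite -mul_vec_lin -/P -BtB mulmxA.
rewrite mulmx_sum_row linear_sum; apply: eq_bigr => i _ /=.
rewrite linearZ /= vec_mxK; congr (_ *: _).
rewrite -mxvec_dot vec_mxK !mxE; apply: eq_bigr => l _.
by rewrite !mxE mulrC.
Qed.

(** * The two orthogonal projections *)

(* As [K] is skew, [K *m A *m K] is [- K A K^T]. *)
Definition proj_anti (R : realType) (n : nat) (K A : 'M[R]_n) : 'M[R]_n :=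
  4^-1 *: ((A + A^T) + K *m (A + A^T) *m K).

(** The factor 1/4 combines symmetrization with averaging over [K]. Anti-invariant matrices are
    traceless by themselves, so only the invariant part carries a trace correction. *)
Definition proj_inv0 (R : realType) (n : nat) (K A : 'M[R]_n) : 'M[R]_n :=
  4^-1 *: ((A + A^T) - K *m (A + A^T) *m K) - (n%:R^-1 * \tr A) *: 1%:M.

Lemma proj_anti_is_linear (R : realType) (n : nat) (K : 'M[R]_n) :
  linear (proj_anti K).
Proof.
move=> a A B; have trE : (a *: A + B)^T = a *: A^T + B^T by rewrite linearD linearZ.
rewrite /proj_anti trE addrACA -scalerDr mulmxDr mulmxDl -scalemxAr -scalemxAl.
by apply/matrixP => i j; rewrite !mxE; ring.
Qed.

HB.instance Definition _ (R : realType) (n : nat) (K : 'M[R]_n) :=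
  GRing.isLinear.Build R 'M[R]_n 'M[R]_n _ (proj_anti K)
    (proj_anti_is_linear K).

Lemma proj_inv0_is_linear (R : realType) (n : nat) (K : 'M[R]_n) :
  linear (proj_inv0 K).
Proof.
move=> a A B; have trE : (a *: A + B)^T = a *: A^T + B^T by rewrite linearD linearZ.
rewrite /proj_inv0 trE mxtraceD mxtraceZ addrACA -scalerDr mulmxDr mulmxDl -scalemxAr.
rewrite -scalemxAl; apply/matrixP => i j; rewrite !mxE; ring.
Qed.

HB.instance Definition _ (R : realType) (n : nat) (K : 'M[R]_n) :=
  GRing.isLinear.Build R 'M[R]_n 'M[R]_n _ (proj_inv0 K)
    (proj_inv0_is_linear K).

Lemma scale_quarter2 (R : realType) (n : nat) (A : 'M[R]_n) :
  4^-1 *: ((A + A) + (A + A)) = A.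
Proof. by apply/matrixP => i j; rewrite !mxE; lra. Qed.

Lemma proj_anti_id (R : realType) (n : nat) (K A : 'M[R]_n) :
  A^T = A -> K *m A *m K = A -> proj_anti K A = A.
Proof.
by move=> sA KA; rewrite /proj_anti sA mulmxDr mulmxDl KA scale_quarter2.
Qed.

Lemma proj_inv0_id (R : realType) (n : nat) (K A : 'M[R]_n) :
  A^T = A -> K *m A *m K = - A -> \tr A = 0 -> proj_inv0 K A = A.
Proof.
move=> sA KA tA; rewrite /proj_inv0 sA mulmxDr mulmxDl KA tA mulr0 scale0r.
by rewrite opprD !opprK subr0 scale_quarter2.
Qed.

Lemma proj_inv0_anti (R : realType) (n : nat) (K A : 'M[R]_n) :
  A^T = A -> K *m A *m K = A -> \tr A = 0 -> proj_inv0 K A = 0.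
Proof.
move=> sA KA tA; rewrite /proj_inv0 sA mulmxDr mulmxDl KA tA mulr0 scale0r.
by rewrite subr0 subrr scaler0.
Qed.

Lemma proj_sum (R : realType) (n : nat) (K A : 'M[R]_n) :
  S20 A -> proj_inv0 K A + proj_anti K A = A.
Proof.
case=> sA tA; rewrite /proj_inv0 /proj_anti sA tA mulr0 scale0r subr0.
rewrite -scalerDr addrACA addNr addr0; exact: scale_quarter2.
Qed.

Lemma proj_anti_sym (R : realType) (n : nat) (K A : 'M[R]_n) :
  K^T = - K -> (proj_anti K A)^T = proj_anti K A.
Proof.
move=> KT; have sA : (A + A^T)^T = A + A^T by rewrite linearD /= trmxK addrC.
rewrite /proj_anti linearZ linearD /= !trmx_mul KT sA.
by rewrite mulNmx !mulmxN opprK mulmxA.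
Qed.

Lemma proj_inv0_sym (R : realType) (n : nat) (K A : 'M[R]_n) :
  K^T = - K -> (proj_inv0 K A)^T = proj_inv0 K A.
Proof.
move=> KT; have sA : (A + A^T)^T = A + A^T by rewrite linearD /= trmxK addrC.
rewrite /proj_inv0 linearB linearZ linearB /= linearZ /= trmx1 !trmx_mul KT sA.
by rewrite mulNmx !mulmxN opprK mulmxA.
Qed.

Lemma conj_twice (R : realType) (n : nat) (K A : 'M[R]_n) :
  K *m K = - 1%:M -> K *m (K *m A *m K) *m K = A.
Proof.
move=> KK; rewrite !mulmxA KK -mulmxA KK.
by rewrite mulmxN mulmx1 mulNmx mul1mx opprK.
Qed.

Lemma proj_anti_conj (R : realType) (n : nat) (K A : 'M[R]_n) :
  K *m K = - 1%:M -> K *m proj_anti K A *m K = proj_anti K A.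
Proof.
move=> KK; rewrite /proj_anti -scalemxAr -scalemxAl mulmxDr mulmxDl conj_twice //.
by rewrite addrC.
Qed.

Lemma proj_inv0_conj (R : realType) (n : nat) (K A : 'M[R]_n) :
  K *m K = - 1%:M -> K *m proj_inv0 K A *m K = - proj_inv0 K A.
Proof.
move=> KK; rewrite /proj_inv0 mulmxBr mulmxBl -!scalemxAr -!scalemxAl.
rewrite mulmxBr mulmxBl conj_twice // mulmx1 KK scalerN.
by rewrite opprB addrC opprK -scalerN opprB.
Qed.

Lemma trace_conj (R : realType) (n : nat) (K A : 'M[R]_n) :
  K *m K = - 1%:M -> \tr (K *m A *m K) = - \tr A.
Proof. by move=> KK; rewrite mxtrace_mulC mulmxA KK mulNmx mul1mx linearN. Qed.

Lemma proj_anti_trace (R : realType) (n : nat) (K A : 'M[R]_n) :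
  K *m K = - 1%:M -> \tr (proj_anti K A) = 0.
Proof.
by move=> KK; rewrite /proj_anti mxtraceZ mxtraceD trace_conj // subrr mulr0.
Qed.

Lemma proj_inv0_trace (R : realType) (n : nat) (K A : 'M[R]_n) :
  K *m K = - 1%:M -> \tr (proj_inv0 K A) = 0.
Proof.
move=> KK; rewrite /proj_inv0 linearB /= !mxtraceZ linearB /= trace_conj //.
rewrite mxtraceD mxtrace_tr mxtrace1.
(* Cancelling [n] against its inverse requires a nonzero dimension; in dimension 0 all traces are
   empty sums. *)
case: n K A KK => [|n] K A KK; first by rewrite /mxtrace !big_ord0; ring.
have : n.+1%:R != 0 :> R by rewrite pnatr_eq0.
by move=> n0; field.
Qed.

Lemma trace_trD (R : realType) (n : nat) (A B C : 'M[R]_n) :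
  \tr ((A + B)^T *m C) = \tr (A^T *m C) + \tr (B^T *m C).
Proof. by rewrite linearD mulmxDl mxtraceD. Qed.

Lemma trace_trB (R : realType) (n : nat) (A B C : 'M[R]_n) :
  \tr ((A - B)^T *m C) = \tr (A^T *m C) - \tr (B^T *m C).
Proof. by rewrite linearB mulmxBl linearB. Qed.

Lemma trace_trZ (R : realType) (n : nat) (a : R) (A C : 'M[R]_n) :
  \tr ((a *: A)^T *m C) = a * \tr (A^T *m C).
Proof. by rewrite linearZ /= -scalemxAl mxtraceZ. Qed.

Lemma trace_mulD (R : realType) (n : nat) (A B C : 'M[R]_n) :
  \tr (C *m (A + B)) = \tr (C *m A) + \tr (C *m B).
Proof. by rewrite mulmxDr mxtraceD. Qed.

Lemma trace_mulB (R : realType) (n : nat) (A B C : 'M[R]_n) :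
  \tr (C *m (A - B)) = \tr (C *m A) - \tr (C *m B).
Proof. by rewrite mulmxBr linearB. Qed.

Lemma trace_mulZ (R : realType) (n : nat) (a : R) (A C : 'M[R]_n) :
  \tr (C *m (a *: A)) = a * \tr (C *m A).
Proof. by rewrite -scalemxAr mxtraceZ. Qed.

Lemma trace_sym_adj (R : realType) (n : nat) (A B : 'M[R]_n) :
  \tr ((A + A^T)^T *m B) = \tr (A^T *m (B + B^T)).
Proof.
rewrite linearD /= trmxK mulmxDl mulmxDr !mxtraceD; congr (_ + _).
by rewrite -mxtrace_tr trmx_mul mxtrace_mulC.
Qed.

Lemma trace_conj_adj (R : realType) (n : nat) (K A B : 'M[R]_n) :
  K^T = - K -> \tr ((K *m A *m K)^T *m B) = \tr (A^T *m (K *m B *m K)).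
Proof.
move=> KT; rewrite !trmx_mul KT mulNmx !mulmxN opprK.
by rewrite -!mulmxA mxtrace_mulC !mulmxA.
Qed.

Lemma sym_conj (R : realType) (n : nat) (K B : 'M[R]_n) : K^T = - K ->
  K *m B *m K + (K *m B *m K)^T = K *m (B + B^T) *m K.
Proof.
move=> KT; rewrite !trmx_mul KT mulNmx !mulmxN opprK mulmxDr mulmxDl.
by rewrite mulmxA.
Qed.

Lemma proj_anti_adj (R : realType) (n : nat) (K A B : 'M[R]_n) :
  K^T = - K ->
  \tr ((proj_anti K A)^T *m B) = \tr (A^T *m proj_anti K B).
Proof.
move=> KT; rewrite /proj_anti trace_trZ trace_mulZ trace_trD trace_mulD.
by rewrite trace_sym_adj trace_conj_adj // trace_sym_adj sym_conj.
Qed.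

Lemma proj_inv0_adj (R : realType) (n : nat) (K A B : 'M[R]_n) :
  K^T = - K ->
  \tr ((proj_inv0 K A)^T *m B) = \tr (A^T *m proj_inv0 K B).
Proof.
move=> KT; rewrite /proj_inv0 trace_trB trace_mulB !trace_trZ !trace_mulZ.
rewrite trace_trB trace_mulB trace_sym_adj trace_conj_adj // trace_sym_adj.
rewrite sym_conj // trmx1 mul1mx mulmx1 mxtrace_tr; ring.
Qed.

(** * Kernels and ranks of the two projections *)

Lemma conj_delta (R : realType) (n : nat) (K : 'M[R]_n) (a b c d : 'I_n) :
  (K *m delta_mx b c *m K) a d = K a b * K c d.
Proof.
rewrite -(mul_delta_mx (0 : 'I_1)) mulmxA -colE -mulmxA -rowE mxE big_ord1.
by rewrite !mxE.
Qed.

Lemma proj_anti_delta (R : realType) (n : nat) (K : 'M[R]_n)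
    (a b c d : 'I_n) :
  proj_anti K (delta_mx b c) a d =
  4^-1 * ((a == b)%:R * (c == d)%:R + (a == c)%:R * (b == d)%:R
          + K a b * K c d + K a c * K b d).
Proof.
have -> : proj_anti K (delta_mx b c) a d
        = 4^-1 * (delta_mx b c a d + delta_mx c b a d
    + (K *m delta_mx b c *m K) a d + (K *m delta_mx c b *m K) a d).
  rewrite /proj_anti trmx_delta mulmxDr mulmxDl.
  move: (K *m delta_mx b c *m K) (K *m delta_mx c b *m K) => X Y.
  by rewrite !mxE; ring.
rewrite !conj_delta !mxE -!mulnb !natrM.
by rewrite (eq_sym d c) (eq_sym d b).
Qed.

Lemma proj_inv0_delta (R : realType) (n : nat) (K : 'M[R]_n)
    (a b c d : 'I_n) :
  proj_inv0 K (delta_mx b c) a d =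
  4^-1 * ((a == b)%:R * (c == d)%:R + (a == c)%:R * (b == d)%:R
          - K a b * K c d - K a c * K b d)
  - n%:R^-1 * ((a == d)%:R * (b == c)%:R).
Proof.
have -> : proj_inv0 K (delta_mx b c) a d
        = 4^-1 * (delta_mx b c a d + delta_mx c b a d
    - (K *m delta_mx b c *m K) a d - (K *m delta_mx c b *m K) a d)
    - n%:R^-1 * \tr (delta_mx b c : 'M[R]_n) * (a == d)%:R.
  rewrite /proj_inv0 trmx_delta mulmxDr mulmxDl; set t := \tr _.
  move: (K *m delta_mx b c *m K) (K *m delta_mx c b *m K) => X Y.
  by rewrite !mxE; ring.
have -> : \tr (delta_mx b c : 'M[R]_n) = (b == c)%:R.
  rewrite -(mul_delta_mx (0 : 'I_1)) mxtrace_mulC.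
  by rewrite mul_delta_mx_cond trace_mx11 eq_sym; case: eqP; rewrite !mxE.
rewrite !conj_delta !mxE -!mulnb !natrM.
rewrite (eq_sym d c) (eq_sym d b); ring.
Qed.
(** Pairing [phi i] with a matrix unit reads off one of its entries. Sums of products of entries
    over the basis thus depend on the projection alone. *)
Lemma onb_kernel (R : realType) (n k : nat) (p : 'M[R]_n -> 'M[R]_n)
    (phi : 'I_k -> 'M[R]_n) (a b c d : 'I_n) :
  (forall A, p A = \sum_i \tr ((phi i)^T *m A) *: phi i) ->
  \sum_i phi i a d * phi i b c = p (delta_mx b c) a d.
Proof.
move=> ->; rewrite summxE; apply: eq_bigr => i _; rewrite mxE mulrC.
congr (_ * _); rewrite -(mul_delta_mx (0 : 'I_1)) mulmxA mxtrace_mulC mulmxA.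
by rewrite -rowE -colE trace_mx11 !mxE.
Qed.

(** The rank of a projection is its trace, computed here on the matrix units. *)
Lemma onb_card (R : realType) (n k : nat) (p : 'M[R]_n -> 'M[R]_n)
    (phi : 'I_k -> 'M[R]_n) :
  (forall i j, \tr ((phi i)^T *m phi j) = (i == j)%:R) ->
  (forall A, p A = \sum_i \tr ((phi i)^T *m A) *: phi i) ->
  k%:R = \sum_b \sum_c p (delta_mx b c) b c.
Proof.
move=> on_phi pE; transitivity (\sum_i \tr ((phi i)^T *m phi i)).
  under eq_bigr do rewrite on_phi eqxx.
  by rewrite sumr_const card_ord.
transitivity (\sum_i \sum_b \sum_c phi i b c * phi i b c).
  apply: eq_bigr => i _; rewrite /mxtrace exchange_big /=.
  by apply: eq_bigr => c _; rewrite mxE; apply: eq_bigr => b _; rewrite mxE.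
rewrite exchange_big; apply: eq_bigr => b _.
rewrite exchange_big; apply: eq_bigr => c _.
exact: onb_kernel.
Qed.

Lemma sum_delta (R : realType) (n : nat) :
  \sum_(b < n) \sum_(c < n) (b == c)%:R * (b == c)%:R = n%:R :> R.
Proof.
transitivity (\sum_(b < n) (1 : R)); last by rewrite sumr_const card_ord.
apply: eq_bigr => b _; rewrite (bigD1 b) //= eqxx mulr1 big1 ?addr0 // => c.
by rewrite eq_sym => /negbTE->; rewrite mul0r.
Qed.

Lemma sum_sqr_skew (R : realType) (n : nat) (K : 'M[R]_n) :
  K^T = - K -> K *m K = - 1%:M ->
  \sum_b \sum_c K b c * K b c = n%:R.
Proof.
move=> KT KK; transitivity (\tr (K *m K^T)).
  by apply: eq_bigr => b _; rewrite mxE; apply: eq_bigr => c _; rewrite mxE.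
by rewrite KT mulmxN KK opprK mxtrace1.
Qed.

Lemma skew_diag (R : realType) (n : nat) (K : 'M[R]_n) (b : 'I_n) :
  K^T = - K -> K b b = 0.
Proof. by move/matrixP/(_ b b); rewrite !mxE; lra. Qed.

Lemma proj_anti_dim (R : realType) (n : nat) (K : 'M[R]_n) :
  K^T = - K -> K *m K = - 1%:M ->
  \sum_b \sum_c proj_anti K (delta_mx b c) b c = 4^-1 * (n%:R ^+ 2 + n%:R *+ 2).
Proof.
move=> KT KK.
transitivity (4^-1 * (\sum_(b < n) \sum_(c < n) 1
   + \sum_(b < n) \sum_(c < n) (b == c)%:R * (b == c)%:R
   + \sum_b \sum_c K b c * K b c)).
  rewrite -!big_split mulr_sumr; apply: eq_bigr => b _ /=.
  rewrite -!big_split mulr_sumr; apply: eq_bigr => c _ /=.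
  by rewrite proj_anti_delta !skew_diag // !eqxx /=; ring.
rewrite sum_delta sum_sqr_skew // !(sumr_const, card_ord) -mulrnA natrM.
ring.
Qed.

Lemma proj_inv0_dim (R : realType) (n : nat) (K : 'M[R]_n) : (0 < n)%N ->
  K^T = - K -> K *m K = - 1%:M ->
  \sum_b \sum_c proj_inv0 K (delta_mx b c) b c = 4^-1 * n%:R ^+ 2 - 1.
Proof.
move=> n0 KT KK.
transitivity (4^-1 * (\sum_(b < n) \sum_(c < n) 1
   + \sum_(b < n) \sum_(c < n) (b == c)%:R * (b == c)%:R
   - \sum_b \sum_c K b c * K b c)
   - n%:R^-1 * (\sum_(b < n) \sum_(c < n) (b == c)%:R * (b == c)%:R)).
  rewrite -sumrN -!big_split !mulr_sumr -sumrN -big_split.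
  apply: eq_bigr => b _ /=.
  rewrite -sumrN -!big_split !mulr_sumr -sumrN -big_split.
  apply: eq_bigr => c _ /=.
  by rewrite proj_inv0_delta !skew_diag // !eqxx /=; ring.
rewrite sum_delta sum_sqr_skew // !(sumr_const, card_ord) -mulrnA natrM.
have : n%:R != 0 :> R by rewrite pnatr_eq0 -lt0n.
by move=> n0'; field.
Qed.

(** * Traces of the curvature operator of the second kind *)

(** Full contraction of the curvature tensor R_abcd, stored as [Q a b d c]. Leaving [F] arbitrary
    lets a trace over a basis be split linearly into elementary contractions. *)
Definition quad_sum (R : realType) (n : nat) (Q : 'I_n -> 'I_n -> 'M[R]_n)
    (F : 'I_n -> 'I_n -> 'I_n -> 'I_n -> R) : R :=
  \sum_a \sum_b \sum_c \sum_d Q a b d c * F a b c d.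

Definition op2 (R : realType) (n : nat) (Q : 'I_n -> 'I_n -> 'M[R]_n)
    (A B : 'M[R]_n) : R :=
  quad_sum Q (fun a b c d => A a d * B b c).

Lemma quad_sum_ext (R : realType) (n : nat) (Q : 'I_n -> 'I_n -> 'M[R]_n)
    (F G : 'I_n -> 'I_n -> 'I_n -> 'I_n -> R) :
  (forall a b c d, F a b c d = G a b c d) -> quad_sum Q F = quad_sum Q G.
Proof.
move=> FG; apply: eq_bigr => a _; apply: eq_bigr => b _; apply: eq_bigr => c _.
by apply: eq_bigr => d _; rewrite FG.
Qed.

Lemma quad_sumD (R : realType) (n : nat) (Q : 'I_n -> 'I_n -> 'M[R]_n)
    (F G : 'I_n -> 'I_n -> 'I_n -> 'I_n -> R) :
  quad_sum Q (fun a b c d => F a b c d + G a b c d)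
  = quad_sum Q F + quad_sum Q G.
Proof.
rewrite /quad_sum -big_split; apply: eq_bigr => a _ /=.
rewrite -big_split; apply: eq_bigr => b _ /=.
rewrite -big_split; apply: eq_bigr => c _ /=.
by rewrite -big_split; apply: eq_bigr => d _ /=; rewrite mulrDr.
Qed.

Lemma quad_sumZ (R : realType) (n : nat) (Q : 'I_n -> 'I_n -> 'M[R]_n)
    (r : R) (F : 'I_n -> 'I_n -> 'I_n -> 'I_n -> R) :
  quad_sum Q (fun a b c d => r * F a b c d) = r * quad_sum Q F.
Proof.
rewrite /quad_sum mulr_sumr; apply: eq_bigr => a _.
rewrite mulr_sumr; apply: eq_bigr => b _; rewrite mulr_sumr.
apply: eq_bigr => c _; rewrite mulr_sumr; apply: eq_bigr => d _; ring.
Qed.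

Lemma sum_op2 (R : realType) (n k : nat) (Q : 'I_n -> 'I_n -> 'M[R]_n)
    (p : 'M[R]_n -> 'M[R]_n) (phi : 'I_k -> 'M[R]_n) :
  (forall A, p A = \sum_i \tr ((phi i)^T *m A) *: phi i) ->
  \sum_i op2 Q (phi i) (phi i)
  = quad_sum Q (fun a b c d => p (delta_mx b c) a d).
Proof.
move=> pE; rewrite /op2 /quad_sum exchange_big; apply: eq_bigr => a _.
rewrite exchange_big; apply: eq_bigr => b _; rewrite exchange_big.
apply: eq_bigr => c _; rewrite exchange_big; apply: eq_bigr => d _.
by rewrite -mulr_sumr (onb_kernel _ _ _ _ pE).
Qed.

Lemma mulmx3E (R : realType) (n : nat) (A B C : 'M[R]_n) (x y : 'I_n) :
  \sum_c \sum_d A x d * B d c * C c y = (A *m B *m C) x y.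
Proof.
by rewrite mxE; apply: eq_bigr => c _; rewrite mxE mulr_suml.
Qed.

(* [Q a b] is the matrix of R(e_a, e_b) acting on row vectors, so that
   R(e_a, e_b, e_c, e_d) is [Q a b d c]. *)
Record kaehler_like (R : realType) (n : nat) (K : 'M[R]_n)
    (Q : 'I_n -> 'I_n -> 'M[R]_n) : Prop := KaehlerLike {
  kl_skew : K^T = - K ;
  kl_sqr : K *m K = - 1%:M ;
  kl_anti : forall a b, Q a b = - Q b a ;
  kl_comm : forall a b, K *m Q a b = Q a b *m K ;
  kl_bianchi : forall a b c d, Q a b c d + Q b c a d + Q c a b d = 0 }.

(** Scalar curvature: [Q a b b a] stands for R(e_a, e_b, e_a, e_b). *)
Definition scal (R : realType) (n : nat) (Q : 'I_n -> 'I_n -> 'M[R]_n) : R :=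
  \sum_a \sum_b Q a b b a.

Lemma kl_conj (R : realType) (n : nat) (K : 'M[R]_n)
    (Q : 'I_n -> 'I_n -> 'M[R]_n) (a b : 'I_n) :
  kaehler_like K Q -> K *m Q a b *m K = - Q a b.
Proof.
by move=> kl; rewrite (kl_comm kl) -mulmxA (kl_sqr kl) mulmxN mulmx1.
Qed.

Lemma quad_sum_trivial (R : realType) (n : nat) (K : 'M[R]_n)
    (Q : 'I_n -> 'I_n -> 'M[R]_n) : kaehler_like K Q ->
  quad_sum Q (fun a b c d => (a == b)%:R * (c == d)%:R) = 0.
Proof.
move=> kl; rewrite /quad_sum big1 // => a _; rewrite big1 // => b _.
rewrite big1 // => c _; rewrite big1 // => d _.
have [<-|] := eqVneq a b; last by rewrite mul0r mulr0.
have /matrixP/(_ d c) := kl_anti kl a a; rewrite mxE => Q0.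
by rewrite (_ : Q a a d c = 0) ?mul0r //; lra.
Qed.

Lemma quad_sum_scal (R : realType) (n : nat) (Q : 'I_n -> 'I_n -> 'M[R]_n) :
  quad_sum Q (fun a b c d => (a == c)%:R * (b == d)%:R) = scal Q.
Proof.
apply: eq_bigr => a _; apply: eq_bigr => b _.
rewrite -[Q a b in RHS]mulmx1 -[Q a b in RHS]mul1mx -mulmx3E.
apply: eq_bigr => c _; apply: eq_bigr => d _; rewrite !mxE (eq_sym c a); ring.
Qed.

Lemma sum_kl_anti (R : realType) (n : nat) (K : 'M[R]_n)
    (Q : 'I_n -> 'I_n -> 'M[R]_n) : kaehler_like K Q ->
  \sum_a \sum_b Q a b a b = - scal Q.
Proof.
move=> kl; rewrite /scal exchange_big -sumrN; apply: eq_bigr => a _ /=.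
by rewrite -sumrN; apply: eq_bigr => b _; rewrite (kl_anti kl) mxE.
Qed.

(** This is the value of the form at the identity matrix; it enters through the trace correction in
    [proj_inv0]. *)
Lemma quad_sum_id (R : realType) (n : nat) (K : 'M[R]_n)
    (Q : 'I_n -> 'I_n -> 'M[R]_n) : kaehler_like K Q ->
  quad_sum Q (fun a b c d => (a == d)%:R * (b == c)%:R) = - scal Q.
Proof.
move=> kl; rewrite -(sum_kl_anti kl).
apply: eq_bigr => a _; apply: eq_bigr => b _.
rewrite -[Q a b in RHS]mulmx1 -[Q a b in RHS]mul1mx -mulmx3E.
apply: eq_bigr => c _; apply: eq_bigr => d _; rewrite !mxE (eq_sym c b); ring.
Qed.

Lemma skewE (R : realType) (n : nat) (K : 'M[R]_n) (a b : 'I_n) :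
  K^T = - K -> K a b = - K b a.
Proof. by move/matrixP/(_ b a); rewrite !mxE. Qed.

(** Summing over [c] and [d] conjugates [Q a b] by [K], which only changes its sign; skewness of [K]
    supplies the second sign. *)
Lemma quad_sum_K13 (R : realType) (n : nat) (K : 'M[R]_n)
    (Q : 'I_n -> 'I_n -> 'M[R]_n) : kaehler_like K Q ->
  quad_sum Q (fun a b c d => K a c * K b d) = scal Q.
Proof.
move=> kl; apply: eq_bigr => a _; apply: eq_bigr => b _.
have -> : Q a b b a = - (K *m Q a b *m K) b a by rewrite kl_conj // !mxE opprK.
rewrite -mulmx3E -sumrN; apply: eq_bigr => c _.
rewrite -sumrN; apply: eq_bigr => d _; rewrite (skewE a c (kl_skew kl)); ring.
Qed.

(** Here [K] pairs the first two indices, so no matrix product appears at once. The Bianchi identity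
    moves them apart, and each of the two resulting terms is a conjugation by [K] contributing one
    [scal Q]. *)
Lemma quad_sum_K12 (R : realType) (n : nat) (K : 'M[R]_n)
    (Q : 'I_n -> 'I_n -> 'M[R]_n) : kaehler_like K Q ->
  quad_sum Q (fun a b c d => K a b * K c d) = scal Q *+ 2.
Proof.
move=> kl; have KT := kl_skew kl.
transitivity (\sum_b \sum_d \sum_c \sum_a K b a * Q b d a c * K c d
   - \sum_d \sum_a \sum_c \sum_b K a b * Q d a b c * K c d).
  transitivity (\sum_a \sum_b \sum_c \sum_d K b a * Q b d a c * K c d
   - \sum_a \sum_b \sum_c \sum_d K a b * Q d a b c * K c d).
    rewrite -sumrB; apply: eq_bigr => a _; rewrite -sumrB; apply: eq_bigr => b _.
    rewrite -sumrB; apply: eq_bigr => c _; rewrite -sumrB; apply: eq_bigr => d _.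
    have := kl_bianchi kl a b d c; rewrite (skewE b a KT) => B.
    by rewrite (_ : Q a b d c = - Q b d a c - Q d a b c); [ring | lra].
  congr (_ - _).
    rewrite exchange_big; apply: eq_bigr => b _ /=.
    rewrite exchange_big [RHS]exchange_big; apply: eq_bigr => c _ /=.
    by rewrite exchange_big.
  rewrite [RHS]exchange_big; apply: eq_bigr => a _ /=.
  rewrite exchange_big [RHS]exchange_big; apply: eq_bigr => c _ /=.
  by rewrite exchange_big.
have -> : \sum_b \sum_d \sum_c \sum_a K b a * Q b d a c * K c d = scal Q.
  rewrite -[RHS]opprK -(sum_kl_anti kl) -sumrN; apply: eq_bigr => b _.
  rewrite -sumrN; apply: eq_bigr => d _.
  by rewrite mulmx3E kl_conj // mxE.
have -> : \sum_d \sum_a \sum_c \sum_b K a b * Q d a b c * K c d = - scal Q.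
  rewrite /scal -sumrN; apply: eq_bigr => d _; rewrite -sumrN.
  by apply: eq_bigr => a _; rewrite mulmx3E kl_conj // mxE.
by rewrite opprK mulr2n.
Qed.

Lemma quad_sum_anti (R : realType) (n : nat) (K : 'M[R]_n)
    (Q : 'I_n -> 'I_n -> 'M[R]_n) : kaehler_like K Q ->
  quad_sum Q (fun a b c d => proj_anti K (delta_mx b c) a d) = scal Q.
Proof.
move=> kl; rewrite (quad_sum_ext _ (proj_anti_delta K)) quad_sumZ !quad_sumD.
rewrite (quad_sum_trivial kl) quad_sum_scal (quad_sum_K12 kl) (quad_sum_K13 kl).
(* The four contractions give (0 + S + 2 S + S) / 4. *)
by field.
Qed.

Lemma quad_sum_inv0 (R : realType) (n : nat) (K : 'M[R]_n)
    (Q : 'I_n -> 'I_n -> 'M[R]_n) : kaehler_like K Q ->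
  quad_sum Q (fun a b c d => proj_inv0 K (delta_mx b c) a d)
  = (n%:R^-1 - 2^-1) * scal Q.
Proof.
move=> kl; pose F (a b c d : 'I_n) : R :=
  4^-1 * ((a == b)%:R * (c == d)%:R + (a == c)%:R * (b == d)%:R
    + (-1) * (K a b * K c d) + (-1) * (K a c * K b d))
  + (- n%:R^-1) * ((a == d)%:R * (b == c)%:R).
rewrite (@quad_sum_ext _ _ _ _ F) => [|a b c d]; last first.
  by rewrite proj_inv0_delta /F; ring.
rewrite /F quad_sumD !quad_sumZ !quad_sumD !quad_sumZ.
rewrite (quad_sum_trivial kl) quad_sum_scal (quad_sum_K12 kl) (quad_sum_K13 kl).
rewrite (quad_sum_id kl).
(* The value is (0 + S - 2 S - S) / 4 + S / n. Generalizing the inverse of [n] avoids a nonvanishing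
   condition. *)
by move: (n%:R^-1 : R) => r; field.
Qed.

Lemma kaehler_like_opp (R : realType) (n : nat) (K : 'M[R]_n)
    (Q : 'I_n -> 'I_n -> 'M[R]_n) :
  kaehler_like K Q -> kaehler_like K (fun a b => - Q a b).
Proof.
case=> KT KK QA KQ QB; split=> // [a b|a b|a b c d].
- by rewrite QA.
- by rewrite mulmxN mulNmx KQ.
- by rewrite !mxE; have := QB a b c d; lra.
Qed.

Lemma op2N (R : realType) (n : nat) (Q : 'I_n -> 'I_n -> 'M[R]_n)
    (A B : 'M[R]_n) :
  op2 (fun a b => - Q a b) A B = - op2 Q A B.
Proof.
rewrite /op2 -mulN1r -quad_sumZ; apply: eq_bigr => a _; apply: eq_bigr => b _.
by apply: eq_bigr => c _; apply: eq_bigr => d _; rewrite mxE; ring.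
Qed.

(** * A basis adapted to the splitting, and its weighted trace *)

Lemma dimS20_double (m : nat) : (0 < m)%N ->
  dimS20 (m + m) = (m ^ 2 - 1 + m * m.+1)%N.
Proof.
case: m => // m _; rewrite /dimS20.
rewrite (_ : (_ * _)%N = (m.+1 ^ 2 - 1 + m.+1 * m.+2) * 2)%N ?mulnK //.
by rewrite -mulnn; nia.
Qed.

(** Each projection provides an orthonormal basis of its image. Indexing their union by a sum type
    keeps the two summands apart, so that each can receive its own weight. *)
Lemma adapted_onb (R : realType) (m : nat) (K : 'M[R]_(m + m)) :
  (0 < m)%N -> K^T = - K -> K *m K = - 1%:M ->
  exists (phi : 'I_(m ^ 2 - 1) + 'I_(m * m.+1) -> 'M[R]_(m + m)),
  [/\ forall i, S20 (phi i),
      forall i j, \tr ((phi i)^T *m phi j) = (i == j)%:R,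
      forall A, proj_inv0 K A
        = \sum_i \tr ((phi (inl i))^T *m A) *: phi (inl i) &
      forall A, proj_anti K A
        = \sum_i \tr ((phi (inr i))^T *m A) *: phi (inr i)].
Proof.
move=> m0 KT KK; have n0 : (0 < m + m)%N by rewrite addn_gt0 m0.
have [A|A B|k1 [phi1 [on1 p1]]] := @projection_onb R _ (proj_inv0 K).
- by apply: proj_inv0_id; [exact: proj_inv0_sym | exact: proj_inv0_conj
    | exact: proj_inv0_trace].
- exact: proj_inv0_adj.
have [A|A B|k2 [phi2 [on2 p2]]] := @projection_onb R _ (proj_anti K).
- by apply: proj_anti_id; [exact: proj_anti_sym | exact: proj_anti_conj].
- exact: proj_anti_adj.
have k1E : k1 = (m ^ 2 - 1)%N.
  apply/eqP; rewrite -(eqr_nat R) (onb_card on1 p1) proj_inv0_dim //.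
  by rewrite natrB ?expn_gt0 ?m0 // natrX natrD; apply/eqP; field.
have k2E : k2 = (m * m.+1)%N.
  apply/eqP; rewrite -(eqr_nat R) (onb_card on2 p2) proj_anti_dim //.
  by rewrite natrM -natr1 natrD; apply/eqP; field.
subst k1 k2.
have fix1 i : proj_inv0 K (phi1 i) = phi1 i.
  rewrite p1 (bigD1 i) //= on1 eqxx scale1r big1 ?addr0 // => j /negbTE ji.
  by rewrite on1 ji scale0r.
have fix2 i : proj_anti K (phi2 i) = phi2 i.
  rewrite p2 (bigD1 i) //= on2 eqxx scale1r big1 ?addr0 // => j /negbTE ji.
  by rewrite on2 ji scale0r.
(* By self-adjointness [proj_inv0] moves to the other factor, an anti-invariant matrix, which it
   kills. *)
have orth i j : \tr ((phi1 i)^T *m phi2 j) = 0.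
  rewrite -fix1 proj_inv0_adj // -fix2 proj_inv0_anti ?mulmx0 ?mxtrace0 //.
  - exact: proj_anti_sym.
  - exact: proj_anti_conj.
  - exact: proj_anti_trace.
exists (fun i => match i with inl i => phi1 i | inr i => phi2 i end).
split=> //.
- case=> i; split; rewrite -1?fix1 -1?fix2.
  + exact: proj_inv0_sym.
  + exact: proj_inv0_trace.
  + exact: proj_anti_sym.
  + exact: proj_anti_trace.
- case=> i; case=> j /=; rewrite ?on1 ?on2 ?orth //.
  by rewrite -mxtrace_tr trmx_mul trmxK orth.
Qed.

Lemma exists_basis_frac_sum_le0 (R : realType) (m : nat) (alpha : R)
    (K : 'M[R]_(m + m)) (Q : 'I_(m + m) -> 'I_(m + m) -> 'M[R]_(m + m)) :
  (0 < m)%N -> 1 <= alpha -> alpha <= 3 / 2 * (m%:R ^+ 2 - 1) ->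
  kaehler_like K Q ->
  exists2 phi : 'I_(dimS20 (m + m)) -> 'M[R]_(m + m),
    orthonormal_basis_S20 phi &
    frac_sum alpha (fun i => op2 Q (phi i) (phi i)) <= 0.
Proof.
move=> m0 alpha1 alpha_le kl; have KT := kl_skew kl; have KK := kl_sqr kl.
have [phi [S20phi on_phi p1 p2]] := adapted_onb m0 KT KK.
pose alpha0 : R := 3 / 2 * (m%:R ^+ 2 - 1).
(* For [m = 1] the bound would be 0, against [1 <= alpha]. *)
have alpha0_gt0 : 0 < alpha0 by apply: lt_le_trans alpha_le; lra.
(* The ratio [r'] balances the two traces, and [r] rescales the total weight: (m^2 - 1) + r' m (m +
   1) = [alpha0]. *)
pose r := alpha / alpha0; pose r' := (m%:R - 1) / (2 * m%:R) : R.
have m1 : 1 <= m%:R :> R by rewrite ler1n.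
have r0 : 0 <= r by rewrite divr_ge0 // ltW //; lra.
have r1 : r <= 1 by rewrite ler_pdivrMr // mul1r.
have r'0 : 0 <= r' by rewrite divr_ge0 //; lra.
have r'1 : r' <= 1 by rewrite ler_pdivrMr; lra.
pose w (i : 'I_(m ^ 2 - 1) + 'I_(m * m.+1)) : R :=
  match i with inl _ => r | inr _ => r * r' end.
have w01 i : 0 <= w i <= 1.
  case: i => _ /=; first by rewrite r0.
  by rewrite mulr_ge0 // mulr_ile1.
have sum_sumType (F : 'I_(m ^ 2 - 1) + 'I_(m * m.+1) -> R) :
    \sum_i F i = \sum_i F (inl i) + \sum_i F (inr i) by exact: big_sumType.
have m_neq0 : m%:R != 0 :> R by lra.
have sum_w : \sum_i w i = alpha.
  rewrite sum_sumType /= !sumr_const !card_ord -[r *+ _]mulr_natr.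
  rewrite -[(r * r') *+ _]mulr_natr natrB ?expn_gt0 ?m0 // natrM natrX -natr1.
  transitivity (r * alpha0); first by rewrite /r' /alpha0; field.
  by rewrite divfK // gt_eqF.
have cardI : #|{: 'I_(m ^ 2 - 1) + 'I_(m * m.+1)}| = dimS20 (m + m).
  by rewrite card_sum !card_ord dimS20_double.
(* The pivot index exists because 3/2 (m^2 - 1) < 2 m^2 + m - 1. *)
have ltN : (Num.truncn alpha < dimS20 (m + m))%N.
  rewrite truncn_lt_nat; last by lra.
  apply: le_lt_trans alpha_le _.
  rewrite dimS20_double // natrD natrB ?expn_gt0 ?m0 // natrM natrX -natr1.
  nra.
have alpha_ge0 : 0 <= alpha by lra.
have [s bij_s le_s] := exists_frac_sum_le
  (fun i => op2 Q (phi i) (phi i)) cardI alpha_ge0 ltN w01 sum_w.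
exists (phi \o s).
  split=> [i|i j|A S20A] /=; first exact: S20phi.
    by rewrite on_phi (inj_eq (bij_inj bij_s)).
  exists (fun i => \tr ((phi (s i))^T *m A)).
  rewrite -{1}(proj_sum K S20A) p1 p2.
  transitivity (\sum_i \tr ((phi i)^T *m A) *: phi i).
    by rewrite big_sumType.
  by rewrite (reindex s) //; apply: onW_bij.
apply: le_trans le_s _; rewrite sum_sumType /= -!mulr_sumr.
rewrite (sum_op2 Q p1) (sum_op2 Q p2) (quad_sum_inv0 kl) (quad_sum_anti kl).
(* The weighted trace is exactly zero: r (1 / (2 m) - 1 / 2) S + r r' S = 0. *)
rewrite le_eqVlt natrD; apply/orP; left; apply/eqP.
have m2_neq0 : m%:R + m%:R != 0 :> R by lra.
by rewrite /r'; move: (scal Q) (r) => S t; field; rewrite m_neq0 m2_neq0.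
Qed.
(** * Curvature of a Kaehler metric in a chart *)

(* The derivative of a non-derivable function is the junk value 0, which is
   compatible with scaling. *)
Lemma pderivZ (R : realType) (n : nat) (i : 'I_n) (r : R)
    (f : 'rV[R]_n -> R) (x : 'rV[R]_n) :
  pderiv i (fun y => r * f y) x = r * pderiv i f x.
Proof.
rewrite /pderiv; set v := delta_mx 0 i.
have dvg h : ~ derivable h x v -> 'D_v h x = 0 :> R by move=> Nd; exact: dvgP.
have [df|Ndf] := pselect (derivable f x v); first exact: deriveMl.
have [->|r0] := eqVneq r 0.
  rewrite mul0r (_ : (fun y => 0 * f y) = cst 0) ?derive_cst //.
  by apply/funext => y; rewrite mul0r.
rewrite (dvg f) // mulr0 dvg // => drf; apply: Ndf.
rewrite (_ : f = (r^-1 \*: (fun y => r * f y : R^o))).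
  exact: derivableZ.
by apply/funext => y; apply: esym (mulKf r0 _).
Qed.

Lemma pderiv_open_ext (R : realType) (n : nat) (U : set 'rV[R]_n) (i : 'I_n)
    (f g : 'rV[R]_n -> R) (x : 'rV[R]_n) :
  open U -> U x -> (forall y, U y -> f y = g y) -> pderiv i f x = pderiv i g x.
Proof.
move=> oU Ux fg; apply: near_eq_derive.
by apply: filterS (open_nbhs_nbhs (conj oU Ux)) => y; apply: fg.
Qed.

Definition Jsign (R : realType) (m : nat) (b : 'I_(m + m)) : R :=
  match fintype.split b with inl _ => 1 | inr _ => -1 end.

Definition Jindex (m : nat) (b : 'I_(m + m)) : 'I_(m + m) :=
  match fintype.split b with inl a => rshift m a | inr a => lshift m a end.

(** The standard complex structure is a signed permutation matrix. Multiplying by it rescales and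
    permutes entries, so identities involving it can be differentiated entrywise with [pderivZ]. *)
Lemma stdJE (R : realType) (m : nat) (b d : 'I_(m + m)) :
  stdJ R m b d = Jsign R b * (d == Jindex b)%:R.
Proof.
rewrite /stdJ /Jsign /Jindex -{1}(fintype.splitK b) -[in LHS](fintype.splitK d).
rewrite -[in RHS](fintype.splitK d).
case: (fintype.split b) => a; case: (fintype.split d) => c /=; rewrite ?block_mxEul
  ?block_mxEur ?block_mxEdl ?block_mxEdr !mxE;
  rewrite ?eq_lshift ?eq_rshift ?eq_lrshift ?eq_rlshift ?mulr0 //.
- by rewrite mul1r eq_sym.
- by rewrite mulN1r eq_sym.
Qed.

Lemma JindexK (m : nat) : involutive (@Jindex m).
Proof.
move=> b; rewrite /Jindex -[RHS]fintype.splitK; case: (fintype.split b) => a /=.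
  by rewrite (fintype.unsplitK (inr a)).
by rewrite (fintype.unsplitK (inl a)).
Qed.

Lemma Jsign_index (R : realType) (m : nat) (b : 'I_(m + m)) :
  Jsign R (Jindex b) = - Jsign R b.
Proof.
rewrite /Jsign /Jindex; case: (fintype.split b) => a /=.
  by rewrite (fintype.unsplitK (inr a)).
by rewrite (fintype.unsplitK (inl a)) opprK.
Qed.

Lemma JsignP (R : realType) (m : nat) (b : 'I_(m + m)) :
  Jsign R b = 1 \/ Jsign R b = -1.
Proof. by rewrite /Jsign; case: (fintype.split b) => _; [left | right]. Qed.

Lemma stdJ_mull (R : realType) (m : nat) (A : 'M[R]_(m + m)) b d :
  (stdJ R m *m A) b d = Jsign R b * A (Jindex b) d.
Proof.
rewrite mxE (bigD1 (Jindex b)) //= big1 ?addr0 => [|j /negbTE jb].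
  by rewrite stdJE eqxx mulr1.
by rewrite stdJE jb mulr0 mul0r.
Qed.

Lemma stdJ_mulr (R : realType) (m : nat) (A : 'M[R]_(m + m)) b d :
  (A *m stdJ R m) b d = - (Jsign R d * A b (Jindex d)).
Proof.
rewrite mxE (bigD1 (Jindex d)) //= big1 ?addr0 => [|j /negbTE jd].
  by rewrite stdJE JindexK eqxx Jsign_index /=; ring.
rewrite stdJE -(inj_eq (inv_inj (@JindexK m))) JindexK eq_sym jd.
by rewrite !mulr0.
Qed.

Lemma stdJ_tr (R : realType) (m : nat) : (stdJ R m)^T = - stdJ R m.
Proof.
rewrite /stdJ tr_block_mx !trmx0 linearN /= !trmx1 opp_block_mx.
by rewrite !oppr0 opprK.
Qed.

Lemma stdJ_sqr (R : realType) (m : nat) : stdJ R m *m stdJ R m = - 1%:M.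
Proof.
rewrite /stdJ mulmx_block !(mul0mx, mulmx0, mul1mx, mulmx1, add0r, addr0).
by rewrite (@scalar_mx_block _ m m) opp_block_mx !oppr0.
Qed.

(** Twice the Christoffel symbols of the first kind. *)
Definition lower_gamma (R : realType) (n : nat) (g : 'rV[R]_n -> 'M[R]_n)
    (x : 'rV[R]_n) (i : 'I_n) : 'M[R]_n :=
  \matrix_(j, l) (pderiv i (fun y => g y j l) x + pderiv j (fun y => g y i l) x
     - pderiv l (fun y => g y i j) x).

(** Row [j] holds the components of nabla_i (d/dx_j): the connection matrix acting on row vectors,
    for which complex linearity is commutation with [stdJ]. *)
Definition gamma_mx (R : realType) (n : nat) (g : 'rV[R]_n -> 'M[R]_n)
    (x : 'rV[R]_n) (i : 'I_n) : 'M[R]_n :=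
  \matrix_(j, k) christoffel g k i j x.

Lemma gamma_mxE (R : realType) (n : nat) (g : 'rV[R]_n -> 'M[R]_n)
    (x : 'rV[R]_n) (i : 'I_n) :
  gamma_mx g x i = 2^-1 *: (lower_gamma g x i *m (invmx (g x))^T).
Proof.
apply/matrixP => j k; rewrite !mxE /christoffel; congr (_ * _).
by apply: eq_bigr => l _; rewrite !mxE mulrC.
Qed.

Definition curv_mx (R : realType) (n : nat) (g : 'rV[R]_n -> 'M[R]_n)
    (x : 'rV[R]_n) (i j : 'I_n) : 'M[R]_n :=
  \matrix_(k, l) riemann_endo g i j k l x.

Lemma curv_mx_anti (R : realType) (n : nat) (g : 'rV[R]_n -> 'M[R]_n)
    (x : 'rV[R]_n) (i j : 'I_n) :
  curv_mx g x i j = - curv_mx g x j i.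
Proof.
apply/matrixP => k l; rewrite !mxE /riemann_endo opprD opprB; congr (_ + _).
by rewrite -sumrN; apply: eq_bigr => s _; rewrite opprB.
Qed.

(** * Symmetries of the curvature of a Kaehler metric on an open set *)

Record kaehler_on (R : realType) (m : nat) (U : set 'rV[R]_(m + m))
    (g : 'rV[R]_(m + m) -> 'M[R]_(m + m)) : Prop := KaehlerOn {
  ko_open : open U ;
  ko_sym : forall x, U x -> (g x)^T = g x ;
  ko_posdef : forall x, U x ->
    forall v : 'rV[R]_(m + m), v != 0 -> 0 < (v *m g x *m v^T) 0 0 ;
  ko_hermitian : forall x, U x -> stdJ R m *m g x *m (stdJ R m)^T = g x ;
  ko_closed : forall x, U x -> forall a b d : 'I_(m + m),
    pderiv a (fun y => (stdJ R m *m g y) b d) x +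
    pderiv b (fun y => (stdJ R m *m g y) d a) x +
    pderiv d (fun y => (stdJ R m *m g y) a b) x = 0 }.

Lemma ko_stdJ_comm (R : realType) (m : nat) (U : set 'rV[R]_(m + m)) g
    (x : 'rV[R]_(m + m)) :
  kaehler_on U g -> U x -> stdJ R m *m g x = g x *m stdJ R m.
Proof.
move=> ko Ux; rewrite -{2}(ko_hermitian ko Ux) -!mulmxA stdJ_tr mulNmx stdJ_sqr.
by rewrite opprK mulmx1.
Qed.

Lemma christoffel_sym (R : realType) (m : nat) (U : set 'rV[R]_(m + m)) g
    (x : 'rV[R]_(m + m)) (k i j : 'I_(m + m)) :
  kaehler_on U g -> U x -> christoffel g k i j x = christoffel g k j i x.
Proof.
move=> ko Ux; rewrite /christoffel; congr (_ * _); apply: eq_bigr => l _.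
congr (_ * _); rewrite [X in X - _ = _]addrC; congr (_ - _).
apply: (pderiv_open_ext _ (ko_open ko)) => // y Uy.
by have /matrixP/(_ i j) := ko_sym ko Uy; rewrite mxE.
Qed.

(** The connection is torsion-free: symmetry of the Christoffel symbols in the lower indices, at [x]
    and after differentiation, cancels the cyclic sum in pairs. *)
Lemma riemann_endo_bianchi (R : realType) (m : nat) (U : set 'rV[R]_(m + m)) g
    (x : 'rV[R]_(m + m)) (i j k l : 'I_(m + m)) :
  kaehler_on U g -> U x ->
  riemann_endo g i j k l x + riemann_endo g j k i l x
  + riemann_endo g k i j l x = 0.
Proof.
move=> ko Ux.
have [D DE] : exists D, forall a b c d,
    pderiv a (christoffel g d b c) x = D a b c d.
  by exists (fun a b c d => pderiv a (christoffel g d b c) x).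
have [C CE] : exists C, forall b c d, christoffel g d b c x = C b c d.
  by exists (fun b c d => christoffel g d b c x).
have Dsym a b c d : D a b c d = D a c b d.
  rewrite -!DE; apply: (pderiv_open_ext _ (ko_open ko)) => // y Uy.
  exact: christoffel_sym ko Uy.
have Csym b c d : C b c d = C c b d.
  by rewrite -!CE; exact: christoffel_sym ko Ux.
have endoE a b c : riemann_endo g a b c l x = D a b c l - D b a c l
    + \sum_s (C b c s * C a s l - C a c s * C b s l).
  rewrite /riemann_endo !DE; congr (_ + _); apply: eq_bigr => s _.
  by rewrite !CE.
rewrite !endoE (Dsym i k j) (Dsym k j i) (Dsym j i k).
have : \sum_s (C j k s * C i s l - C i k s * C j s l)
     + \sum_s (C k i s * C j s l - C j i s * C k s l)
     + \sum_s (C i j s * C k s l - C k j s * C i s l) = 0.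
  rewrite -!big_split big1 //= => s _.
  rewrite (Csym k j) (Csym k i) (Csym i j); ring.
lra.
Qed.

(** For a complex structure with constant components, g((nabla_X J) Y, Z) is up to a constant factor
    d omega(X, Y, Z) - d omega(X, J Y, J Z), and both terms vanish. *)
Lemma lower_gamma_comm (R : realType) (m : nat) (U : set 'rV[R]_(m + m)) g
    (x : 'rV[R]_(m + m)) (i : 'I_(m + m)) :
  kaehler_on U g -> U x ->
  stdJ R m *m lower_gamma g x i = lower_gamma g x i *m stdJ R m.
Proof.
move=> ko Ux; have oU := ko_open ko.
have [G GE] : exists G, forall a b d, pderiv a (fun y => g y b d) x = G a b d.
  by exists (fun a b d => pderiv a (fun y => g y b d) x).
have Gsym a b d : G a b d = G a d b.
  rewrite -!GE; apply: (pderiv_open_ext _ oU) => // y Uy.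
  by have /matrixP/(_ d b) := ko_sym ko Uy; rewrite mxE.
have GJ a b d : G a b d = Jsign R b * Jsign R d * G a (Jindex b) (Jindex d).
  rewrite -!GE -pderivZ; apply: (pderiv_open_ext _ oU) => // y Uy.
  have /matrixP/(_ b d) := ko_hermitian ko Uy.
  by rewrite stdJ_tr mulmxN mxE stdJ_mulr stdJ_mull => <-; ring.
have closed a b d : Jsign R b * G a (Jindex b) d + Jsign R d * G b (Jindex d) a
                  + Jsign R a * G d (Jindex a) b = 0.
  rewrite -(ko_closed ko Ux a b d) -!GE -!pderivZ.
  by congr (_ + _ + _); apply: (pderiv_open_ext _ oU) => // y Uy;
    rewrite stdJ_mull.
apply/matrixP => j k; rewrite stdJ_mull stdJ_mulr !mxE !GE.
(* The two values of d omega in that formula, followed by three derivatives of the hermitian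
   condition. Once the signs are fixed to 1 or -1, everything is linear in the derivatives of the
   metric. *)
have := closed i j k; have := closed i (Jindex j) (Jindex k).
have := GJ i (Jindex j) k; have := GJ k i (Jindex j); have := GJ (Jindex k) i j.
rewrite !JindexK !Jsign_index (Gsym j _ i) (Gsym (Jindex j) _ i).
by case: (JsignP R i) => ->; case: (JsignP R j) => ->; case: (JsignP R k) => ->;
  lra.
Qed.

(* The Levi-Civita connection is complex linear: nabla J = 0. *)
Lemma gamma_mx_comm (R : realType) (m : nat) (U : set 'rV[R]_(m + m)) g
    (x : 'rV[R]_(m + m)) (i : 'I_(m + m)) :
  kaehler_on U g -> U x ->
  stdJ R m *m gamma_mx g x i = gamma_mx g x i *m stdJ R m.
Proof.
move=> ko Ux; rewrite gamma_mxE -scalemxAr -scalemxAl; congr (_ *: _).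
rewrite mulmxA (lower_gamma_comm i ko Ux) -!mulmxA; congr (_ *m _).
have Jg := ko_stdJ_comm ko Ux.
rewrite trmx_inv (ko_sym ko Ux).
(* On a singular matrix [invmx] is the identity map, and [g x] itself commutes with [stdJ]. *)
have [gU|gNU] := boolP (g x \in unitmx); last by rewrite invmx_out.
apply: (can_inj (mulKmx gU)); rewrite mulmxA -Jg -mulmxA mulmxV // mulmx1.
by rewrite mulKVmx.
Qed.

(** The curvature is d_i Gamma_j - d_j Gamma_i plus a commutator of connection matrices. These
    commute with [stdJ] on all of [U], hence so do their derivatives and products. *)
Lemma curv_mx_comm (R : realType) (m : nat) (U : set 'rV[R]_(m + m)) g
    (x : 'rV[R]_(m + m)) (i j : 'I_(m + m)) :
  kaehler_on U g -> U x ->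
  stdJ R m *m curv_mx g x i j = curv_mx g x i j *m stdJ R m.
Proof.
move=> ko Ux; pose D a b := \matrix_(k, l) pderiv a (christoffel g l b k) x.
have curvE : curv_mx g x i j = D i j - D j i
    + (gamma_mx g x j *m gamma_mx g x i - gamma_mx g x i *m gamma_mx g x j).
  apply/matrixP => k l; rewrite !mxE /riemann_endo; congr (_ + _).
  by rewrite sumrB; congr (_ - _); apply: eq_bigr => s _; rewrite !mxE.
have DJ a b : stdJ R m *m D a b = D a b *m stdJ R m.
  apply/matrixP => k l; rewrite stdJ_mull stdJ_mulr !mxE.
  rewrite -mulNr -!pderivZ; apply: (pderiv_open_ext _ (ko_open ko)) => // y Uy.
  have /matrixP/(_ k l) := gamma_mx_comm b ko Uy.
  by rewrite stdJ_mull stdJ_mulr !mxE mulNr.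
have GJ a := gamma_mx_comm a ko Ux.
rewrite curvE mulmxDr mulmxDl !mulmxBr !mulmxBl !DJ !mulmxA !GJ.
by rewrite -!mulmxA !GJ !mulmxA.
Qed.

(** * Passage to an orthonormal frame *)

Definition frame_J (R : realType) (m : nat) (G E : 'M[R]_(m + m)) :
    'M[R]_(m + m) :=
  E *m stdJ R m *m (G *m E^T).

(* [G *m E^T] is the inverse of the orthonormal frame [E]. *)
Definition frame_curv (R : realType) (n : nat) (g : 'rV[R]_n -> 'M[R]_n)
    (x : 'rV[R]_n) (E : 'M[R]_n) (a b : 'I_n) : 'M[R]_n :=
  \sum_i \sum_j (E a i * E b j) *: (E *m curv_mx g x i j *m (g x *m E^T)).

Lemma kaehler_like_frame (R : realType) (m : nat) (U : set 'rV[R]_(m + m)) g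
    (x : 'rV[R]_(m + m)) (E : 'M[R]_(m + m)) :
  kaehler_on U g -> U x -> orthonormal_frame (g x) E ->
  kaehler_like (frame_J (g x) E) (frame_curv g x E).
Proof.
move=> ko Ux; rewrite /orthonormal_frame -mulmxA => EF.
have Jg := ko_stdJ_comm ko Ux.
have FE := mulmx1C EF; split.
- rewrite /frame_J !trmx_mul trmxK (ko_sym ko Ux) stdJ_tr mulNmx mulmxN.
  by rewrite -!mulmxA (mulmxA (g x)) -Jg !mulmxA.
- rewrite /frame_J; move: EF FE; move: (g x *m E^T) => F EF FE.
  rewrite !mulmxA -(mulmxA _ F E) FE mulmx1 -(mulmxA E) stdJ_sqr.
  by rewrite mulmxN mulmx1 mulNmx EF.
- move=> a b; rewrite /frame_curv exchange_big -sumrN; apply: eq_bigr => i _.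
  rewrite -sumrN; apply: eq_bigr => j _.
  by rewrite curv_mx_anti mulmxN mulNmx scalerN mulrC.
- move=> a b; rewrite /frame_curv mulmx_sumr mulmx_suml; apply: eq_bigr => i _.
  rewrite mulmx_sumr mulmx_suml; apply: eq_bigr => j _.
  rewrite -scalemxAr -scalemxAl; congr (_ *: _).
  rewrite /frame_J; move: FE; move: (g x *m E^T) => F FE.
  rewrite !mulmxA -!(mulmxA _ F E) FE !mulmx1.
  by rewrite -(mulmxA E (stdJ R m)) (curv_mx_comm i j ko Ux) !mulmxA.
- move=> a b c d.
  pose T i j k := (curv_mx g x i j *m (g x *m E^T)) k d.
  have T0 i j k : T i j k + T j k i + T k i j = 0.
    rewrite /T; move: (g x *m E^T) => F.
    rewrite ![(_ *m F) _ _]mxE -!big_split big1 //= => l _.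
    by rewrite -!mulrDl !mxE (riemann_endo_bianchi i j k l ko Ux) mul0r.
  have QE a' b' c' : frame_curv g x E a' b' c' d
      = \sum_i \sum_j \sum_k E a' i * E b' j * E c' k * T i j k.
    rewrite summxE; apply: eq_bigr => i _; rewrite summxE; apply: eq_bigr => j _.
    rewrite mxE -mulmxA mxE mulr_sumr; apply: eq_bigr => k _.
    by rewrite mulrA.
  rewrite !QE.
  (* Cyclic renaming of the summation indices gives the three sums the common coefficient
     [E a i * E b j * E c k], whose cofactor is the Bianchi sum in coordinates. *)
  have -> : \sum_i \sum_j \sum_k E b i * E c j * E a k * T i j k
          = \sum_i \sum_j \sum_k E b j * E c k * E a i * T j k i.
    rewrite [RHS]exchange_big; apply: eq_bigr => i _ /=.
    by rewrite [RHS]exchange_big.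
  have -> : \sum_i \sum_j \sum_k E c i * E a j * E b k * T i j k
          = \sum_i \sum_j \sum_k E c k * E a i * E b j * T k i j.
    rewrite exchange_big; apply: eq_bigr => i _ /=.
    by rewrite exchange_big.
  rewrite -!big_split big1 //= => i _; rewrite -!big_split big1 //= => j _.
  rewrite -!big_split big1 //= => k _.
  transitivity (E a i * E b j * E c k * (T i j k + T j k i + T k i j)).
    by move: (T i j k) (T j k i) (T k i j) => t1 t2 t3; ring.
  by rewrite T0 mulr0.
Qed.

Lemma curv_op2E (R : realType) (n : nat) (g : 'rV[R]_n -> 'M[R]_n)
    (x : 'rV[R]_n) (E A B : 'M[R]_n) :
  (g x)^T = g x -> curv_op2 g x E A B = op2 (frame_curv g x E) A B.
Proof.
move=> gT; apply: eq_bigr => a _; apply: eq_bigr => b _; apply: eq_bigr => c _.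
apply: eq_bigr => d _; rewrite -mulrA; congr (_ * _).
rewrite /riemann /frame_curv summxE; apply: eq_bigr => i _.
rewrite summxE; apply: eq_bigr => j _; rewrite [RHS]mxE.
have -> : E *m curv_mx g x i j *m (g x *m E^T)
        = E *m (curv_mx g x i j *m g x) *m E^T by rewrite !mulmxA.
rewrite -mulmx3E mulr_sumr.
apply: eq_bigr => k _; rewrite mulr_sumr; apply: eq_bigr => l _.
rewrite -[in RHS]gT !mxE.
have -> : \sum_s g x k s * riemann_endo g i j l s x
        = \sum_s curv_mx g x i j l s * (g x)^T s k.
  by apply: eq_bigr => s _; rewrite !mxE mulrC.
move: (\sum_s _) => S; ring.
Qed.

Lemma kaehler_on_chart (R : realType) (m : nat) (M : kaehlerManifold R m)
    (c : chart M) : kaehler_on (chart_img c) (km_metric M c).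
Proof.
split.
- exact: chart_img_open.
- exact: rm_sym.
- exact: rm_posdef.
- exact: km_hermitian.
- exact: km_closed.
Qed.

Theorem corollary1p4 (R : realType) (m : nat) (alpha : R)
    (m_gt0 : (0 < m)%N) (alpha_ge1 : 1 <= alpha)
    (alpha_le : alpha <= 3 / 2 * (m%:R ^+ 2 - 1)) :
  ~ (exists M : kaehlerManifold R m,
       alpha_positive M alpha \/ alpha_negative M alpha).
Proof.
case=> M posneg; have [p _] := cm_nonempty M.
have [c cp] := chart_cover p; set x := chart_map c p.
have Ux : chart_img c x by exists p.
have ko := kaehler_on_chart c; have gT := ko_sym ko Ux.
have [E onE] := posdef_frame gT (ko_posdef ko Ux).
have kl := kaehler_like_frame ko Ux onE.
case: posneg => [pos|neg].
  have [phi on_phi] := exists_basis_frac_sum_le0 m_gt0 alpha_ge1 alpha_le kl.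
  apply/negP; rewrite -ltNge; have := pos p c cp E onE phi on_phi.
  by under eq_fun do rewrite curv_op2E //.
have [phi on_phi] := exists_basis_frac_sum_le0 m_gt0 alpha_ge1 alpha_le
  (kaehler_like_opp kl).
have := neg p c cp E onE phi on_phi; under eq_fun do rewrite curv_op2E //.
have -> : (fun i => op2 (fun a b => - frame_curv (km_metric M c) x E a b)
                      (phi i) (phi i))
   = (fun i => - op2 (frame_curv (km_metric M c) x E) (phi i) (phi i)).
  by apply/funext => i; rewrite op2N.
by rewrite frac_sumN oppr_le0 => /lt_geF ->.
Qed.
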